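(* Let $\sigma\colon A^*\to A^*$ be a morphism prolongable on $a\in A$ and let $\mathbf{x}=\sigma^{\omega}(a)=x_0x_1\cdots$. Suppose that $\sigma$ is recognizable on $\mathbf{x}$ with a computable recognizability constant $C$ and that $\mathbf{x}$ is $k$-automatic. Then the cutting set $\mathsf{CS}_{\sigma,a}=\{|\sigma(\mathrm{pref}_n(\mathbf{x}))|\colon n\ge0\}$ is $k$-definable.
   Context: $\sigma$ is prolongable on $a$ if $\sigma(a)=au$ and $|\sigma^n(a)|\to\infty$; $\sigma^{\omega}(a)=\lim_n\sigma^n(a)$. $\mathrm{pref}_n(\mathbf{x})$ is the length-$n$ prefix of $\mathbf{x}$, and $\mathbf{x}[i,j]=x_i\cdots x_j$. Write $p_i=|\sigma(x_0\cdots x_{i-1})|$. $\sigma$ is recognizable on $\mathbf{x}$ if there is a constant $C>0$ such that for all $n\ge0$ and all $i$ with $p_i\ge C$: if $\mathbf{x}[n-C,n+C]=\mathbf{x}[p_i-C,p_i+C]$, then there exists $j$ with $n=p_j$ and $x_i=x_j$; the least such $C$ is the constant of recognizability of $\sigma$ on $\mathbf{x}$. An infinite word is $k$-automatic if some deterministic finite automaton with output reading the base-$k$ representation of $n$ outputs its $n$-th letter. A set $E\subseteq\mathbb{N}$ is $k$-definable if it is first-order definable in $\langle\mathbb{N},+,V_k\rangle$ ($V_k(n)$ the largest power of $k$ dividing $n$), equivalently the base-$k$ representations of its elements form a regular language. *)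

(* Defs.v *)
From mathcomp Require Export all_boot.

Set Implicit Arguments.
Unset Strict Implicit.
Unset Printing Implicit Defensive.

Section Words.
Variable A : finType.
Implicit Types (sigma : seq A -> seq A) (a : A) (x : nat -> A).

Definition word_morphism sigma : Prop :=
  sigma [::] = [::] /\ {morph sigma : u v / u ++ v}.

Definition prolongable sigma a : Prop :=
  (exists u, sigma [:: a] = a :: u) /\
  (forall m, exists n0, forall n, n0 <= n -> m <= size (iter n sigma [:: a])).

Definition pref n x : seq A := mkseq x n.

(* Limit of finite words, without assuming that they are prefixes of each
   other: each prefix of [x] is a prefix of all but finitely many [w n]. *)
Definition word_limit (w : nat -> seq A) x : Prop :=
  forall m, exists n0, forall n, n0 <= n -> prefix (pref m x) (w n).

Definition fixed_point_word sigma a x : Prop :=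
  word_limit (fun n => iter n sigma [:: a]) x.

(* The word x_i ... x_j, both ends included. *)
Definition factor x i j : seq A := [seq x l | l <- iota i (j.+1 - i)].

Definition cutpoint sigma x i : nat := size (sigma (pref i x)).

(* For n < C the window around n would start at a negative position.
   Truncated subtraction makes [factor x (n - C) (n + C)] start at 0, with
   length n + C + 1 < 2C + 1, so it differs from every full window
   around a position p_i >= C. *)
Definition recognizable_with sigma x C : Prop :=
  0 < C /\
  forall n i, let p := cutpoint sigma x in
    C <= p i ->
    factor x (n - C) (n + C) = factor x (p i - C) (p i + C) ->
    exists j, n = p j /\ x i = x j.

Definition recognizable sigma x : Prop := exists C, recognizable_with sigma x C.

Definition recognizability_constant sigma x C : Prop :=
  recognizable_with sigma x C /\
  forall C', recognizable_with sigma x C' -> C <= C'.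

Definition cutting_set sigma x : nat -> Prop :=
  fun m => exists n, m = size (sigma (pref n x)).

End Words.

Record dfao (k : nat) (A : Type) := DFAO {
  dfao_state : finType;
  dfao_init : dfao_state;
  dfao_trans : dfao_state -> 'I_k -> dfao_state;
  dfao_out : dfao_state -> A
}.

Definition dfao_eval k A (M : dfao k A) (w : seq 'I_k) : A :=
  dfao_out (foldl (@dfao_trans k A M) (dfao_init M) w).

(* Most significant digit first, no leading zero; 0 is represented by the
   empty word. *)
Definition base_rep k (w : seq 'I_k) (n : nat) : Prop :=
  foldl (fun v (d : 'I_k) => v * k + d) 0 w = n /\
  (forall d w', w = d :: w' -> d != 0 :> nat).

Definition automatic k A (x : nat -> A) : Prop :=
  exists M : dfao k A, forall w n, base_rep w n -> dfao_eval M w = x n.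

(* The largest power of k dividing n (for 1 < k and 0 < n), with the usual
   convention V_k(0) = 1. *)
Definition Vk (k n : nat) : nat := \max_(i < n.+1 | k ^ i %| n) k ^ i.

Inductive term : Type :=
  | Var of nat
  | Add of term & term
  | Val of term.

Inductive formula : Type :=
  | Eq of term & term
  | Not of formula
  | And of formula & formula
  | Or of formula & formula
  | Implies of formula & formula
  | Exists of nat & formula
  | Forall of nat & formula.

Section Semantics.
Variable k : nat.

Fixpoint eval (e : nat -> nat) (t : term) : nat :=
  match t with
  | Var i => e i
  | Add t1 t2 => eval e t1 + eval e t2
  | Val t1 => Vk k (eval e t1)
  end.

Definition update (e : nat -> nat) (i m : nat) : nat -> nat :=
  fun j => if j == i then m else e j.

Fixpoint holds (e : nat -> nat) (f : formula) : Prop :=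
  match f with
  | Eq t1 t2 => eval e t1 = eval e t2
  | Not g => ~ holds e g
  | And g h => holds e g /\ holds e h
  | Or g h => holds e g \/ holds e h
  | Implies g h => holds e g -> holds e h
  | Exists i g => exists m, holds (update e i m) g
  | Forall i g => forall m, holds (update e i m) g
  end.

(* Variable 0 is the free variable of the defining formula; quantifying over
   the whole valuation excludes parameters. *)
Definition definable (E : nat -> Prop) : Prop :=
  exists f, forall e, holds e f <-> E (e 0).

End Semantics.

(* Main.v *)
Require Import Defs.
From mathcomp Require Import all_boot zify.
From Stdlib Require Import Classical FunctionalExtensionality.

Set Implicit Arguments.
Unset Strict Implicit.
Unset Printing Implicit Defensive.

(** Recognizability makes the cut points that are at least C exactly the
    positions whose window of radius C belongs to a fixed finite set of words,
    so the cutting set is first-order definable from the sets {n | x_n = b}.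
    Those are definable by Büchi's argument: a run of the automaton on n is
    encoded by one number per state q, whose base-k digit at position j is 1
    when the run is in state q after reading all the digits of n but the last j. *)

(** * Arithmetic in base k *)

Section Arithmetic.
Variable k : nat.
Hypothesis k_gt1 : 1 < k.

Let k_gt0 : 0 < k := ltnW k_gt1.

Let expk_gt0 j : 0 < k ^ j.
Proof. by rewrite expn_gt0 k_gt0. Qed.

Lemma Vk_attained n : exists2 i, k ^ i %| n & Vk k n = k ^ i.
Proof.
have P0 : 0 < #|[pred i : 'I_n.+1 | k ^ i %| n]|.
  by apply/card_gt0P; exists ord0; rewrite inE dvd1n.
have [i Pi Vi] := eq_bigmax_cond (fun i : 'I_n.+1 => k ^ i) P0.
by exists (i : nat); rewrite // /Vk -Vi.
Qed.

Lemma leq_Vk n i : 0 < n -> k ^ i %| n -> k ^ i <= Vk k n.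
Proof.
move=> n_gt0 kin.
have lt_in : i < n.+1.
  exact: leq_trans (ltn_expl i k_gt1) (leqW (dvdn_leq n_gt0 kin)).
exact: (leq_bigmax_cond (F := fun i : 'I_n.+1 => k ^ i) (Ordinal lt_in)).
Qed.

(** Makes the powers of [k] definable by a single equation. The number 0 is no solution, as [Vk k 0]
    is 1. *)
Lemma Vk_fixedP n : Vk k n = n <-> exists j, n = k ^ j.
Proof.
split=> [<-|[j ->]]; first by have [i _ ->] := Vk_attained n; exists i.
have [i dv Vi] := Vk_attained (k ^ j).
by apply/eqP; rewrite eqn_leq leq_Vk // andbT Vi dvdn_leq.
Qed.

Lemma ltn_Vk w j : 0 < w -> (k ^ j < Vk k w) = (k ^ j.+1 %| w).
Proof.
move=> w_gt0; apply/idP/idP => [|dv].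
  have [i dv ->] := Vk_attained w; rewrite ltn_exp2l // => lt_ji.
  exact: dvdn_trans (dvdn_exp2l _ lt_ji) dv.
by apply: leq_trans (leq_Vk w_gt0 dv); rewrite ltn_exp2l.
Qed.

(** Splits [n] into the part [u] below position [j], the digit [d], and the part [w] above, a
    multiple of [k ^ j.+1]. Given [k ^ j], the left side uses only addition, order and [Vk]; the
    case [w + w = w] covers [w = 0], where [Vk k 0 = 1] fails the comparison. *)
Lemma digitP n j d : d < k ->
  (exists u w, [/\ n = d * k ^ j + (u + w), u < k ^ j
                 & w + w = w \/ k ^ j < Vk k w])
  <-> (n %/ k ^ j) %% k = d.
Proof.
move=> d_lt; split=> [[u [w [-> ult ww]]]|<-].
  have dv : k ^ j.+1 %| w.
    have [->|w_gt0] := posnP w; first exact: dvdn0.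
    by case: ww => [|]; [lia | rewrite ltn_Vk].
  have /dvdnP[c ->] := dv.
  have -> : d * k ^ j + (u + c * k ^ j.+1) = (d + c * k) * k ^ j + u.
    by rewrite expnS; lia.
  by rewrite divnMDl // divn_small // addn0 addnC modnMDl modn_small.
exists (n %% k ^ j), ((n %/ k ^ j) %/ k * k ^ j.+1); split.
- rewrite [LHS](divn_eq n (k ^ j)) {1}(divn_eq (n %/ k ^ j) k) expnS; lia.
- exact: ltn_pmod.
have [->|w_gt0] := posnP ((n %/ k ^ j) %/ k * k ^ j.+1); first by left.
by right; rewrite ltn_Vk // dvdn_mull.
Qed.

(** Supplies the numbers that encode a finite run, one per state; the induction peels off the lowest
    digit. *)
Lemma bits_number (chi : nat -> bool) L :
  exists Y, forall j, j < L -> (Y %/ k ^ j) %% k = chi j.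
Proof.
elim: L chi => [|L IH] chi; first by exists 0.
have [Y HY] := IH (fun j => chi j.+1).
have b_lt : chi 0 < k by case: (chi 0).
exists (Y * k + chi 0) => -[|j] jL.
  by rewrite expn0 divn1 modnMDl modn_small.
by rewrite expnS divnMA divnMDl // (divn_small b_lt) addn0 HY.
Qed.

(** The bounds make [L] the number of base-[k] digits of [n]: a larger exponent would give at least
    [k * (n + 1)], which exceeds [k * n + 1]. The [+ 1] admits [L = 0] for [n = 0]. *)
Lemma exp_bracket_unique n L L' :
  n < k ^ L -> k ^ L <= k * n + 1 -> n < k ^ L' -> k ^ L' <= k * n + 1 -> L = L'.
Proof.
wlog le_LL' : L L' / L <= L'.
  by move=> H ? ? ? ?; case/orP: (leq_total L L') => ?; [|symmetry]; apply: H.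
move=> h1 h2 h3 h4; apply/eqP; rewrite eqn_leq le_LL' /= leqNgt.
apply/negP => lt_LL'.
have : k ^ L.+1 <= k ^ L' by rewrite leq_exp2l.
rewrite expnS; nia.
Qed.

Lemma exp_bracket n : exists2 L, n < k ^ L & k ^ L <= k * n + 1.
Proof.
have [->|n_gt0] := posnP n; first by exists 0; rewrite ?expn0 ?muln0.
exists (trunc_log k n).+1; first exact: trunc_log_ltn.
by rewrite expnS (leq_trans _ (leq_addr _ _)) // leq_mul2l trunc_logP ?orbT.
Qed.

(** * Base-k representations and runs of the automaton *)

Definition last_digit n : 'I_k := Ordinal (ltn_pmod n k_gt0).

(* The first argument is fuel; [n] suffices. *)
Fixpoint digits_rec f n : seq 'I_k :=
  if f is f'.+1 then
    if n == 0 then [::] else rcons (digits_rec f' (n %/ k)) (last_digit n)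
  else [::].

Definition digits n := digits_rec n n.

Lemma digits_rec_enough f g n : n <= f -> n <= g -> digits_rec f n = digits_rec g n.
Proof.
elim: f g n => [|f IH] [|g] n //=; rewrite ?leqn0; try by [move=> /eqP-> | move=> _ /eqP->].
case: eqP => // /eqP n0 nf ng; have lt : n %/ k < n by rewrite ltn_Pdiv ?lt0n.
by congr rcons; apply: IH; lia.
Qed.

Lemma digitsS n : 0 < n -> digits n = rcons (digits (n %/ k)) (last_digit n).
Proof.
case: n => // n _; rewrite /digits [LHS]/=; congr rcons.
have : n.+1 %/ k < n.+1 by rewrite ltn_Pdiv.
by move=> ?; apply: digits_rec_enough; lia.
Qed.

Lemma base_rep_digits n : base_rep (digits n) n.
Proof.
elim/ltn_ind: n => n IH; have [->|n_gt0] := posnP n; first by split.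
have [vn lead] := IH (n %/ k) (ltn_Pdiv k_gt1 n_gt0).
rewrite digitsS // /base_rep -cats1 foldl_cat vn /=; split; first by rewrite -divn_eq.
(* If the quotient has no digits it is 0, so a zero last digit would give [n = 0]. *)
case E : (digits (n %/ k)) lead => [|c w] lead d w' /= [<- _].
  apply/eqP => m0; have {}m0 : n %% k = 0 := m0; move: vn; rewrite E /= => d0.
  by have := divn_eq n k; rewrite -d0 m0; lia.
exact: (lead c w).
Qed.

Section Run.
Variables (A : Type) (M : dfao k A).

Definition state n := foldl (dfao_trans (d := M)) (dfao_init M) (digits n).

(** The digits of the quotients [n %/ k ^ j] are the prefixes of [digits n], so their states make up
    the run on [n], indexed by the number of digits left to read. *)
Lemma state_step n : 0 < n -> state n = dfao_trans (state (n %/ k)) (last_digit n).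
Proof. by move=> n_gt0; rewrite /state digitsS // -cats1 foldl_cat. Qed.

End Run.

End Arithmetic.

(** * First-order formulas *)

(** Exceeds every variable of [t], hence serves as a fresh variable for quantifiers. *)
Fixpoint tbound t : nat :=
  match t with
  | Var i => i.+1
  | Add t1 t2 => maxn (tbound t1) (tbound t2)
  | Val t1 => tbound t1
  end.

Definition False_f := Not (Eq (Var 0) (Var 0)).

Definition conj (I : Type) (s : seq I) F :=
  foldr (fun i => And (F i)) (Not False_f) s.
Definition disj (I : Type) (s : seq I) F :=
  foldr (fun i => Or (F i)) False_f s.

Definition le_f t1 t2 :=
  let i := maxn (tbound t1) (tbound t2) in Exists i (Eq (Add t1 (Var i)) t2).
Definition lt_f t1 t2 := Not (le_f t2 t1).

(** The multiple is added onto a term [t'] because the language has no constant 0 from which to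
    start a sum. *)
Definition scale_add d t t' := iter d (Add t) t'.

(* [z] stands for a power of [k]. *)
Definition digit_f (n z : term) (d : nat) :=
  let u := maxn (tbound n) (tbound z) in
  Exists u (Exists u.+1
    (And (Eq n (scale_add d z (Add (Var u) (Var u.+1))))
    (And (lt_f (Var u) z)
         (Or (Eq (Add (Var u.+1) (Var u.+1)) (Var u.+1))
             (lt_f z (Val (Var u.+1))))))).

Section Formulas.
Variable k : nat.
Hypothesis k_gt1 : 1 < k.
Implicit Types (e : nat -> nat) (t : term).

Lemma eval_agree e e' t :
  (forall i, i < tbound t -> e i = e' i) -> eval k e t = eval k e' t.
Proof.
elim: t => [i|t1 IH1 t2 IH2|t IH] /= H; first by apply: H.
  by rewrite IH1 ?IH2 // => i lt_i; apply: H; rewrite leq_max lt_i ?orbT.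
by rewrite IH.
Qed.

Lemma eval_update e t i m : tbound t <= i -> eval k (update e i m) t = eval k e t.
Proof.
by move=> le_i; apply: eval_agree => j lt_j; rewrite /update ifN //; lia.
Qed.

Lemma eval_scale_add e d t t' :
  eval k e (scale_add d t t') = d * eval k e t + eval k e t'.
Proof. by elim: d => //= d ->; rewrite mulSn addnA. Qed.

Lemma holds_conj (I : eqType) (s : seq I) F e :
  holds k e (conj s F) <-> forall i, i \in s -> holds k e (F i).
Proof.
elim: s => [|i s IH]; rewrite /conj /=; first by split=> // _ H; apply: H.
rewrite -/(conj s F).
split=> [[Hi /IH Hs] j|H].
  by rewrite inE => /orP[/eqP->|]; [|exact: Hs].
split; first by apply: H; rewrite mem_head.
by apply/IH => j js; apply: H; rewrite inE js orbT.
Qed.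

Lemma holds_disj (I : eqType) (s : seq I) F e :
  holds k e (disj s F) <-> exists2 i, i \in s & holds k e (F i).
Proof.
elim: s => [|i s IH]; rewrite /disj /=; first by split=> [[]|[]].
rewrite -/(disj s F).
split=> [[Hi|/IH[j js Hj]]|[j]].
- by exists i; rewrite ?mem_head.
- by exists j; rewrite // inE js orbT.
by rewrite inE => /orP[/eqP-> ?|js Hj]; [left | right; apply/IH; exists j].
Qed.

(* The predicate P may be undecidable, so the formula itself is not explicit. *)
Lemma disj_selected (I : eqType) (s : seq I) (P : I -> Prop) F :
  exists f, forall e, holds k e f <-> exists i, [/\ i \in s, P i & holds k e (F i)].
Proof.
have [s' Hs'] : exists s' : seq I, forall i, i \in s' <-> i \in s /\ P i.
  elim: s => [|i s [s' IH]]; first by exists [::] => i; split => [|[]].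
  have [Pi|nPi] := classic (P i).
    exists (i :: s') => j; rewrite !inE; split.
      by case/orP => [/eqP->|/IH[-> ?]]; rewrite ?eqxx ?orbT.
    by case=> /orP[->//|js Pj]; apply/orP; right; apply/IH.
  exists s' => j; rewrite inE; split; first by move/IH => [-> ?]; rewrite orbT.
  by case=> /orP[/eqP-> /nPi //|js Pj]; apply/IH.
exists (disj s' F) => e; rewrite holds_disj; split.
  by case=> i /Hs'[? ?] ?; exists i.
by case=> i [? ? ?]; exists i => //; apply/Hs'.
Qed.

Lemma holds_le e t1 t2 : holds k e (le_f t1 t2) <-> eval k e t1 <= eval k e t2.
Proof.
rewrite /le_f /=; split=> [[m]|le].
  by rewrite /= !eval_update ?leq_maxl ?leq_maxr // => <-; apply: leq_addr.
exists (eval k e t2 - eval k e t1).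
by rewrite !eval_update ?leq_maxl ?leq_maxr // /update eqxx subnKC.
Qed.

Lemma holds_lt e t1 t2 : holds k e (lt_f t1 t2) <-> eval k e t1 < eval k e t2.
Proof.
have H := holds_le e t2 t1; rewrite ltnNge; split=> [nle|/negP nle /H //].
by apply/negP => /H.
Qed.

Opaque conj disj le_f lt_f.

Lemma holds_digit e n z d j : d < k -> eval k e z = k ^ j ->
  holds k e (digit_f n z d) <-> (eval k e n %/ k ^ j) %% k = d.
Proof.
move=> d_lt zj; rewrite -(digitP k_gt1) // /digit_f.
set u := maxn _ _.
have nu : tbound n <= u by rewrite leq_maxl.
have zu : tbound z <= u by rewrite leq_maxr.
(* Both quantified variables are fresh, so [n] and [z] keep their values. *)
have step a b : let e' := update (update e u a) u.+1 b in
  [/\ eval k e' n = eval k e n, eval k e' z = k ^ j, e' u = a & e' u.+1 = b].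
  rewrite /= !eval_update ?(leqW nu) ?(leqW zu) //.
  by rewrite /update !eqxx ltn_eqF.
split=> -[a [b]]; have [En Ez Eu Ew] := step a b.
  case=> h1 [h2 h3]; exists a, b; move: h1 h3.
  rewrite /= eval_scale_add /= En Ez Eu Ew => -> h3; split=> //.
    by move/holds_lt: h2; rewrite /= Ez Eu.
  by case: h3 => [|/holds_lt]; rewrite /= ?Ez ?Ew; [left | right].
case=> h1 h2 h3; exists a, b; split; [|split].
- by rewrite /= eval_scale_add /= En Ez Eu Ew.
- by apply/holds_lt; rewrite /= Ez Eu.
by case: h3 => h3; [left | right; apply/holds_lt]; rewrite /= ?Ez Ew.
Qed.

Opaque digit_f.

(** Lets a block of quantifiers, one per state, be instantiated at once by a whole valuation. *)
Lemma holds_Foralls (l : seq nat) f e :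
  holds k e (foldr Forall f l) <->
  forall e', (forall j, j \notin l -> e' j = e j) -> holds k e' f.
Proof.
elim: l e => [|i l IH] e /=.
  split=> [H e' He'|H]; last exact: H.
  by have -> : e' = e by apply: functional_extensionality => j; apply: He'.
split=> [H e' He'|H m].
  have /IH := H (e' i); apply=> j jl; rewrite /update.
  by case: eqP => [-> //|/eqP ji]; apply: He'; rewrite inE negb_or ji.
apply/IH => e' He'; apply: H => j; rewrite inE negb_or => /andP[ji jl].
by rewrite He' // /update (negPf ji).
Qed.

(** * Letters of an automatic word *)

Section Letter.
Variables (A : finType) (M : dfao k A).
Let Q := dfao_state M.

(* [one] is a term of value 1. The power of k held by [Var v] exceeds [n] by
   at least 1, yet is at most [k * n + 1], so its exponent is the number of
   digits of [n]. The numbers encoding the run are quantified universally,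
   subject to containing the run: the run is the least solution. *)
Definition letter_f (n one : term) (b : A) :=
  let v := maxn (tbound n) (tbound one) in
  let P := Var v in
  let Z := Var v.+1 in
  let Y (q : Q) := Var (v.+2 + enum_rank q) in
  let closed :=
    Forall v.+1 (Defs.Implies (And (Eq (Val Z) Z) (lt_f Z P))
      (conj (enum {: Q * 'I_k}) (fun qd =>
        Defs.Implies (And (digit_f (Y qd.1) (scale_add k.-1 Z Z) 1) (digit_f n Z qd.2))
          (digit_f (Y (dfao_trans qd.1 qd.2)) Z 1)))) in
  Exists v (And (And (Eq (Val P) P) (And (lt_f n P) (le_f P (scale_add k n one))))
    (foldr Forall
      (Defs.Implies (And (digit_f (Y (dfao_init M)) P 1) closed)
        (disj [seq q <- enum Q | dfao_out q == b] (fun q => digit_f (Y q) one 1)))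
      (iota v.+2 #|Q|))).

(** From formula to letter, the universal numbers are instantiated by the actual run, whose only
    state at position 0 is [run 0]. Conversely, any numbers satisfying the premise contain the run,
    so [run 0] is the witness. *)
Lemma holds_letter e n one b : eval k e one = 1 ->
  holds k e (letter_f n one b) <-> dfao_out (state k_gt1 M (eval k e n)) = b.
Proof.
move=> one1; rewrite /letter_f.
set v := maxn _ _; set N := eval k e n; set Yv := fun q : Q => v.+2 + enum_rank q.
have nv : tbound n <= v by rewrite leq_maxl.
have ov : tbound one <= v by rewrite leq_maxr.
have k_gt0 := ltnW k_gt1.
(* With [Z] equal to [k ^ j], this sum names [k ^ j.+1], the preceding position of the run. *)
have kk Z : k.-1 * Z + Z = k * Z by rewrite -{2}(prednK k_gt0) mulSn addnC.
(* Positions decrease along the run: it starts at [L], and digit [j] of [N] leads from position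
   [j.+1] to [j]. *)
pose closed (bit : Q -> nat -> Prop) L := bit (dfao_init M) L /\
  forall j, j < L -> forall q, bit q j.+1 ->
    bit (dfao_trans q (last_digit k_gt1 (N %/ k ^ j))) j.
pose digit1 (e' : nat -> nat) (q : Q) j := (e' (Yv q) %/ k ^ j) %% k = 1.
have digit1P e' q t j : eval k e' t = k ^ j ->
    holds k e' (digit_f (Var (Yv q)) t 1) <-> digit1 e' q j by apply: holds_digit.
set body := Defs.Implies _ _.
(* The valuation [e'] is arbitrary on the variables [Yv q] that encode the run. *)
have bodyP e' L : (forall i, i < v -> e' i = e i) -> e' v = k ^ L ->
    holds k e' body <-> (closed (digit1 e') L ->
      exists2 q, dfao_out q = b & digit1 e' q 0).
  move=> agr ev.
  have En : eval k e' n = N by apply: eval_agree => i ?; apply: agr; lia.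
  have E1 : eval k e' one = 1.
    by rewrite -one1; apply: eval_agree => i ?; apply: agr; lia.
  have concl : holds k e' (disj [seq q <- enum Q | dfao_out q == b]
      (fun q => digit_f (Var (Yv q)) one 1)) <->
      exists2 q, dfao_out q = b & digit1 e' q 0.
    rewrite holds_disj; split=> -[q].
      by rewrite mem_filter mem_enum andbT => /eqP qb /(digit1P _ _ _ 0 E1); exists q.
    move=> qb H; exists q; first by rewrite mem_filter mem_enum qb eqxx.
    exact/(digit1P _ _ _ 0 E1).
  have prem : closed (digit1 e') L <-> holds k e' (And
      (digit_f (Var (Yv (dfao_init M))) (Var v) 1)
      (Forall v.+1 (Defs.Implies
        (And (Eq (Val (Var v.+1)) (Var v.+1)) (lt_f (Var v.+1) (Var v)))
      (conj (enum {: Q * 'I_k}) (fun qd =>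
        Defs.Implies (And (digit_f (Var (Yv qd.1)) (scale_add k.-1 (Var v.+1) (Var v.+1)) 1)
                     (digit_f n (Var v.+1) qd.2))
          (digit_f (Var (Yv (dfao_trans qd.1 qd.2))) (Var v.+1) 1)))))).
    have init : holds k e' (digit_f (Var (Yv (dfao_init M))) (Var v) 1) <->
        digit1 e' (dfao_init M) L by apply: digit1P.
    have upd j : let e2 := update e' v.+1 (k ^ j) in
        [/\ eval k e2 n = N, e2 v.+1 = k ^ j, e2 v = k ^ L
          & forall q, e2 (Yv q) = e' (Yv q)].
      rewrite /= eval_update ?(leqW nv) // /update eqxx ltn_eqF //; split=> // q.
      by rewrite ifN // /Yv; lia.
    have E2kZ j : eval k (update e' v.+1 (k ^ j))
        (scale_add k.-1 (Var v.+1) (Var v.+1)) = k ^ j.+1.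
      by have [_ E2Z _ _] := upd j; rewrite eval_scale_add /= E2Z kk expnS.
    split=> [[H0 Hs]|[/init H0 Hs]]; split=> //; first exact/init.
      move=> m [/(Vk_fixedP k_gt1)[j mj] ltm].
      have {mj} Em : m = k ^ j by move: mj; rewrite /= /update eqxx.
      subst m; have [E2n E2Z E2P E2Y] := upd j.
      have digitZ := digit1P (update e' v.+1 (k ^ j)) _ (Var v.+1) j E2Z.
      have digitkZ := digit1P (update e' v.+1 (k ^ j)) _
        (scale_add k.-1 (Var v.+1) (Var v.+1)) j.+1 (E2kZ j).
      move/holds_lt: ltm; rewrite /= E2Z E2P ltn_exp2l // => jL.
      apply/holds_conj => -[q d] _ [h1 h2]; apply/digitZ.
      rewrite /digit1 E2Y.
      have -> : d = last_digit k_gt1 (N %/ k ^ j).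
        apply/val_inj; symmetry; rewrite /= -E2n.
        exact/(holds_digit n (ltn_ord d) (E2Z : eval k _ (Var v.+1) = _)).
      apply: Hs => //; rewrite /digit1 -(E2Y q).
      exact/digitkZ.
    move=> j jL q Hq; have [E2n E2Z E2P E2Y] := upd j.
    have digitZ := digit1P (update e' v.+1 (k ^ j)) _ (Var v.+1) j E2Z.
    have digitkZ := digit1P (update e' v.+1 (k ^ j)) _
      (scale_add k.-1 (Var v.+1) (Var v.+1)) j.+1 (E2kZ j).
    rewrite /digit1 -(E2Y (dfao_trans _ _)).
    apply/digitZ.
    have side : holds k (update e' v.+1 (k ^ j))
        (And (Eq (Val (Var v.+1)) (Var v.+1)) (lt_f (Var v.+1) (Var v))).
      split; first by rewrite /= E2Z; apply/Vk_fixedP => //; exists j.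
      by apply/holds_lt; rewrite /= E2Z E2P ltn_exp2l.
    have /holds_conj := Hs (k ^ j) side.
    move/(_ (q, last_digit k_gt1 (N %/ k ^ j)) (mem_enum _ _)); apply; split.
      by apply/digitkZ; rewrite /digit1 E2Y.
    by apply/(holds_digit n (ltn_ord _) (E2Z : eval k _ (Var v.+1) = _)); rewrite E2n.
  by split=> H /prem Hp; apply/concl; apply: H.
have [L NL LN] := exp_bracket k_gt1 N.
pose run j := state k_gt1 M (N %/ k ^ j).
have run_init : run L = dfao_init M by rewrite /run divn_small.
have run_step j : j < L ->
    run j = dfao_trans (run j.+1) (last_digit k_gt1 (N %/ k ^ j)).
  move=> jL; rewrite /run expnSr divnMA; apply: state_step.
  (* A step of the run needs a nonzero quotient; for [j < L] the bracket gives
     [k ^ j <= k ^ L.-1 <= N]. *)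
  rewrite divn_gt0 ?expn_gt0 ?k_gt0 //.
  clear run_init; case: L jL NL LN => // L jL NL; rewrite expnS => LN.
  have le_jL : k ^ j <= k ^ L by rewrite leq_exp2l.
  by apply: leq_trans le_jL _; rewrite leqNgt; apply/negP => lt_NL; nia.
have run0 : run 0 = state k_gt1 M N by rewrite /run expn0 divn1.
have upd m : eval k (update e v m) n = N /\ eval k (update e v m) one = 1.
  by rewrite !eval_update.
have bracketP m : holds k (update e v m) (And (Eq (Val (Var v)) (Var v))
    (And (lt_f n (Var v)) (le_f (Var v) (scale_add k n one)))) <-> m = k ^ L.
  have [En E1] := upd m.
  have Em : update e v m v = m by rewrite /update eqxx.
  split=> [[/= /(Vk_fixedP k_gt1)[L' HL'] [/holds_lt h1 /holds_le h2]]|mL].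
    move: h1 h2; rewrite eval_scale_add /= En E1 HL' => h1 h2.
    by rewrite -Em HL' (exp_bracket_unique k_gt1 h1 h2 NL LN).
  split; [|split]; [|apply/holds_lt|apply/holds_le].
  - by rewrite /= Em; apply/Vk_fixedP => //; exists L.
  - by rewrite /= En Em mL.
  by rewrite eval_scale_add /= En E1 Em mL.
have block_agree (e' : nat -> nat) :
    (forall j, j \notin iota v.+2 #|Q| -> e' j = update e v (k ^ L) j) ->
    (forall i, i < v -> e' i = e i) /\ e' v = k ^ L.
  move=> He'; split=> [i iv|]; rewrite He' ?mem_iota ?/update ?eqxx //; try lia.
  by rewrite ltn_eqF.
rewrite -run0; split.
  case=> m [/bracketP-> /holds_Foralls H].
  have bits q : exists Y, forall j, j < L.+1 -> (Y %/ k ^ j) %% k = (run j == q).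
    exact: bits_number.
  have [Y HY] := fin_all_exists bits.
  (* Inside the block, [insub] turns a variable into the rank of a state. The test [j < v.+2] is
     there because truncated subtraction sends all smaller variables to 0. *)
  pose e' j := if insub (j - v.+2) is Some i then
                 if j < v.+2 then update e v (k ^ L) j else Y (enum_val (i : 'I_#|Q|))
               else update e v (k ^ L) j.
  have e'Y q : e' (Yv q) = Y q.
    rewrite /e' /Yv addKn insubT // => lt_q; rewrite ifN; last by lia.
    by congr Y; rewrite -[RHS]enum_rankK; congr enum_val; apply: val_inj.
  have He' j : j \notin iota v.+2 #|Q| -> e' j = update e v (k ^ L) j.
    rewrite mem_iota /e'; case: insubP => //= i lt_i _; case: ifP => //; lia.
  have [agr ev] := block_agree _ He'.
  have bitE q j : j <= L -> digit1 e' q j <-> run j = q.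
    rewrite /digit1 e'Y => jL; rewrite HY //; split=> [|->]; last by rewrite eqxx.
    by case: eqP.
  have [|q qb] := (bodyP _ _ agr ev).1 (H _ He').
    split; first exact/bitE.
    by move=> j jL q /bitE Hq; apply/bitE; [lia | rewrite run_step // Hq].
  by move/bitE=> -> //.
move=> outb; exists (k ^ L); split; first exact/bracketP.
apply/holds_Foralls => e' He'; have [agr ev] := block_agree _ He'.
apply/(bodyP _ _ agr ev) => -[H0 Hs]; exists (run 0) => //.
(* Induction down the positions, from [L], where the run starts, to 0. *)
suff {outb} H j : j <= L -> digit1 e' (run (L - j)) (L - j).
  by have := H L (leqnn L); rewrite subnn.
elim: j => [|j IH] jL; first by rewrite subn0 run_init.
have := Hs (L - j.+1); rewrite run_step; last lia.
have -> : (L - j.+1).+1 = L - j by lia.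
by apply; [lia | apply: IH; lia].
Qed.

End Letter.

End Formulas.

(** * Definability of the cutting set *)

Lemma automatic_state (A : Type) k (x : nat -> A) (k_gt1 : 1 < k) :
  automatic k x -> exists M : dfao k A, forall n, dfao_out (state k_gt1 M n) = x n.
Proof.
by case=> M HM; exists M => n; rewrite -(HM _ _ (base_rep_digits k_gt1 n)).
Qed.

(** A cut point from [C] on is its own witness; conversely, recognizability makes a cut point of any
    position sharing its window with a cut point at least [C]. Below [C] only finitely many values
    remain. *)
Lemma cutting_setE (A : finType) (sigma : seq A -> seq A) (x : nat -> A) C m :
  recognizable_with sigma x C ->
  cutting_set sigma x m <->
  (m < C /\ cutting_set sigma x m) \/
  (C <= m /\ exists2 i, C <= cutpoint sigma x i
     & factor x (m - C) (m + C) =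
       factor x (cutpoint sigma x i - C) (cutpoint sigma x i + C)).
Proof.
case=> _ rec; split=> [cm|[[] //|[_ [i Ci eqf]]]].
  have [Cm|mC] := leqP C m; [right | by left].
  by split=> //; case: cm => i mi; exists i; rewrite /cutpoint -mi.
by have [j [-> _]] := rec m i Ci eqf; exists j.
Qed.

Theorem theorem15 (A : finType) (sigma : seq A -> seq A) (a : A)
    (x : nat -> A) (C k : nat) :
  word_morphism sigma ->
  prolongable sigma a ->
  fixed_point_word sigma a x ->
  recognizable sigma x ->
  recognizability_constant sigma x C ->
  1 < k ->
  automatic k x ->
  definable k (cutting_set sigma x).
Proof.
move=> _ _ _ _ [rec _] k_gt1 /(automatic_state k_gt1)[M HM].
(* Variable 2 will be forced to 0 by [zero + zero = zero]; its [Vk] is then the constant 1. *)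
pose zero := Var 2; pose one := Val zero.
have [small Hsmall] := disj_selected k (iota 0 C) (cutting_set sigma x)
  (fun c => Eq (Var 0) (scale_add c one zero)).
pose W := (C + C).+1.
(* There are finitely many words of length [2C + 1], so the windows of cut points can be listed in a
   formula. *)
pose window (w : W.-tuple A) := exists2 i, C <= cutpoint sigma x i
  & tval w = factor x (cutpoint sigma x i - C) (cutpoint sigma x i + C).
have [large Hlarge] := disj_selected k (enum {: W.-tuple A}) window
  (fun w => conj (enum 'I_W)
    (fun l => letter_f M (scale_add l one (Var 1)) one (tnth w l))).
(* Variable 1 holds the start of the window around variable 0; the equation with [C] added says at
   once that the position is at least [C] and avoids subtraction. *)
exists (Exists 2 (And (Eq (Add zero zero) zero)
  (Or small (Exists 1 (And (Eq (Var 0) (scale_add C one (Var 1))) large))))) => e.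
have Vk0 : Vk k 0 = 1 by rewrite /Vk big_mkcond big_ord_recl big_ord0 dvd1n.
rewrite (cutting_setE _ rec); set e0 := update e 2 0.
have Hs : holds k e0 small <-> e 0 < C /\ cutting_set sigma x (e 0).
  rewrite Hsmall; split=> [[c [cC cc]]|[lt cc]].
    rewrite /= eval_scale_add /= /e0 /update /= Vk0 muln1 addn0 => ->.
    by move: cC; rewrite mem_iota.
  exists (e 0); rewrite mem_iota; split=> //.
  by rewrite /= eval_scale_add /= /e0 /update /= Vk0 muln1 addn0.
have Hl n : holds k (update e0 1 n) large <->
    exists2 w, window w & forall l : 'I_W, x (l + n) = tnth w l.
  have E1 : eval k (update e0 1 n) one = 1 by rewrite /= /e0 /update /= Vk0.
  have El l : eval k (update e0 1 n) (scale_add l one (Var 1)) = l + n.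
    by rewrite eval_scale_add E1 muln1.
  rewrite Hlarge; split=> [[w [_ Hw /holds_conj H]]|[w Hw H]]; exists w => //.
    move=> l; have /(holds_letter k_gt1 M _ _ E1) := H l (mem_enum _ _).
    by rewrite HM El.
  split=> //; first by rewrite mem_enum.
  by apply/holds_conj => l _; apply/(holds_letter k_gt1 M _ _ E1); rewrite HM El.
have factorE n : size (factor x n (n + C + C)) = W /\
    forall l : 'I_W, nth (x 0) (factor x n (n + C + C)) l = x (l + n).
  have -> : factor x n (n + C + C) = [seq x l | l <- iota n W].
    by rewrite /factor; congr (map _ (iota _ _)); rewrite /W; lia.
  rewrite size_map size_iota; split=> // l.
  by rewrite (nth_map 0) ?size_iota // nth_iota // addnC.
split.
  case=> z [/= zz]; have {zz} -> : z = 0 by move: zz; rewrite /update /=; lia.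
  case=> [/Hs|[n [/= mn /Hl[w [i Ci wi] H]]]]; [by left | right].
  move: mn; rewrite eval_scale_add /= /update /= Vk0 muln1 => ->.
  rewrite leq_addr; split=> //; exists i => //; rewrite -wi addKn (addnC C n).
  have [sz Hn] := factorE n.
  apply: (@eq_from_nth _ (x 0)); first by rewrite sz size_tuple.
  move=> l; rewrite sz => lW.
  by rewrite (Hn (Ordinal lW)) H (tnth_nth (x 0)).
move=> H; exists 0; split; first by rewrite /= /update.
case: H => [H|[Cm [i Ci eqf]]]; [left; exact/Hs | right].
exists (e 0 - C); split.
  by rewrite /= eval_scale_add /= /update /= Vk0 muln1 subnKC.
have [sz Hn] := factorE (e 0 - C); rewrite subnK // in sz Hn.
have szb : size (factor x (e 0 - C) (e 0 + C)) == W by apply/eqP.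
apply/Hl; exists (Tuple szb); first by exists i.
by move=> l; rewrite (tnth_nth (x 0)) /= Hn.
Qed.
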